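(* Let $M^n$ be an $n$-dimensional Minkowski space with unit ball $K$ and unit sphere $S$, and let $\mathbf{x}\in S$. The bounded representation $\Phi(B(-\mathbf{x},\mathbf{x}))$ of the bisector of $-\mathbf{x}$ and $\mathbf{x}$ is the union of the shadow boundary $S(K,\mathbf{x})$ and the set of the midpoints of the chords of $K$ parallel to $\mathbf{x}$.
   Context: Setting: $K$ is a convex body (compact, convex, with nonempty interior) in $n$-dimensional Euclidean space $E^n$, centrally symmetric with respect to the origin. $M^n$ denotes $E^n$ with the norm $\|\cdot\|$ whose unit ball is $K$ (an $n$-dimensional real normed space, called a Minkowski space), and $S=\{\mathbf{y} : \|\mathbf{y}\|=1\}$ is the boundary of $K$. The shadow boundary $S(K,\mathbf{x})$ of $K$ with respect to the direction $\mathbf{x}$ is the intersection of $S$ with the union of all supporting lines of $K$ having direction $\mathbf{x}$ (lines parallel to $\mathbf{x}$ that meet $K$ but not its interior). A chord of $K$ parallel to $\mathbf{x}$ is the intersection of $K$ with a line parallel to $\mathbf{x}$ that meets $K$. Compactification: $E^n$ is compactified to a closed ball $B^n$ by adding one ideal point $\mathbf{y}_\infty$ for each direction $\mathbf{y}\in S$ (so $-\mathbf{y}_\infty\neq\mathbf{y}_\infty$). Bisector: for $\mathbf{x}\in S$, the ordinary points of $B(-\mathbf{x},\mathbf{x})$ are the $\mathbf{z}\in E^n$ with $\|\mathbf{z}-\mathbf{x}\|=\|\mathbf{z}+\mathbf{x}\|$. The ideal points of $B(-\mathbf{x},\mathbf{x})$ are those $\mathbf{y}_\infty$ ($\mathbf{y}\in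 S$) for which there are $\mathbf{y}_i\in S$ and reals $t_i>0$ with $t_i\to\infty$ such that every $t_i\mathbf{y}_i$ is an ordinary point of $B(-\mathbf{x},\mathbf{x})$ and $\mathbf{y}_i\to\mathbf{y}$. $B(-\mathbf{x},\mathbf{x})$ consists of its ordinary and ideal points. Bounded representation: define $\Phi:B(-\mathbf{x},\mathbf{x})\to K$ by $\Phi(\mathbf{z})=\frac{1}{t_{\mathbf{z}}}\mathbf{z}$ for an ordinary point $\mathbf{z}$, where $t_{\mathbf{z}}=\|\mathbf{z}-\mathbf{x}\|=\|\mathbf{z}+\mathbf{x}\|\ge 1$, i.e. $t_{\mathbf{z}}$ is the unique value with $\mathbf{z}\in(t_{\mathbf{z}}S+\mathbf{x})\cap(t_{\mathbf{z}}S-\mathbf{x})$, and by $\Phi(\mathbf{y}_\infty)=\mathbf{y}$ for an ideal point $\mathbf{y}_\infty$. The bounded representation of the bisector is the image $\Phi(B(-\mathbf{x},\mathbf{x}))\subseteq K$. *)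

(* Defs.v *)
From HB Require Import structures.
From mathcomp Require Import all_boot all_order all_algebra.
From mathcomp Require Import all_classical all_reals all_analysis.
Import Order.TTheory GRing.Theory Num.Theory.
Import numFieldNormedType.Exports.

Set Implicit Arguments.
Unset Strict Implicit.
Unset Printing Implicit Defensive.

Local Open Scope classical_set_scope.
Local Open Scope convex_scope.
Local Open Scope ring_scope.

(* The n-dimensional Euclidean space is 'rV[R]_n; only its vector space
   structure and its usual topology are used. *)

Definition convex_body (R : realType) (n : nat) (K : set 'rV[R]_n) : Prop :=
  [/\ compact K, convex_set (K : set (convex_lmodType 'rV[R]_n))
    & K° !=set0].

Definition centrally_symmetric (R : realType) (n : nat)
    (K : set 'rV[R]_n) : Prop := forall y, K y -> K (- y).

(* Gauge (Minkowski functional) of K: for a centrally symmetric convex body,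
   this is the norm whose unit ball is K. *)
Definition mnorm (R : realType) (n : nat) (K : set 'rV[R]_n)
    (z : 'rV[R]_n) : R :=
  inf [set t : R | 0 < t /\ [set t *: y | y in K] z].

Definition msphere (R : realType) (n : nat) (K : set 'rV[R]_n) :
  set 'rV[R]_n := [set y | mnorm K y = 1].

Definition lines_along (R : realType) (n : nat) (x : 'rV[R]_n) :
    set (set 'rV[R]_n) :=
  range (fun p : 'rV[R]_n => range (fun s : R => p + s *: x)).

Definition supporting_line (R : realType) (n : nat)
    (K L : set 'rV[R]_n) : Prop := L `&` K !=set0 /\ L `&` K° = set0.

Definition shadow_boundary (R : realType) (n : nat) (K : set 'rV[R]_n)
    (x : 'rV[R]_n) : set 'rV[R]_n :=
  msphere K `&`
  \bigcup_(L in [set L | lines_along x L /\ supporting_line K L]) L.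

Definition chords (R : realType) (n : nat) (K : set 'rV[R]_n)
    (x : 'rV[R]_n) : set (set 'rV[R]_n) :=
  [set K `&` L | L in [set L | lines_along x L /\ L `&` K !=set0]].

Definition segment (R : realType) (n : nat) (a b : 'rV[R]_n) :
    set 'rV[R]_n :=
  range (fun t : {i01 R} => (a : convex_lmodType 'rV[R]_n) <| t |> b).

(* Chords may be degenerate (a = b). *)
Definition is_midpoint (R : realType) (n : nat) (C : set 'rV[R]_n)
    (m : 'rV[R]_n) : Prop :=
  exists a b, C = segment a b /\ m = 2^-1 *: (a + b).

Definition chord_midpoints (R : realType) (n : nat) (K : set 'rV[R]_n)
    (x : 'rV[R]_n) : set 'rV[R]_n :=
  [set m | exists2 C, chords K x C & is_midpoint C m].

(* Underlying point set of the compactification of the space to a closed ball: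
   one ideal point for each y in the unit sphere, so that the ideal points of
   y and - y differ. *)
Inductive cpoint (R : realType) (n : nat) (K : set 'rV[R]_n) : Type :=
| Ordinary of 'rV[R]_n
| Ideal of msphere K.
Arguments Ordinary {R n K} _.
Arguments Ideal {R n K} _.

Definition bisector_ord (R : realType) (n : nat) (K : set 'rV[R]_n)
    (x : 'rV[R]_n) : set 'rV[R]_n :=
  [set z | mnorm K (z - x) = mnorm K (z + x)].

Definition bisector_ideal (R : realType) (n : nat) (K : set 'rV[R]_n)
    (x : 'rV[R]_n) : set (msphere K) :=
  [set y | exists (u : nat -> 'rV[R]_n) (t : nat -> R),
    [/\ forall i, msphere K (u i),
        forall i, 0 < t i,
        t @ \oo --> +oo,
        forall i, bisector_ord K x (t i *: u i)
      & u @ \oo --> val y]].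
Arguments bisector_ideal {R n} K x _.

(* The bisector B(-x, x) with its ideal points. *)
Definition bisector (R : realType) (n : nat) (K : set 'rV[R]_n)
    (x : 'rV[R]_n) : set (cpoint K) :=
  [set p | match p with
           | Ordinary z => bisector_ord K x z
           | Ideal y => bisector_ideal K x y
           end].
Arguments bisector {R n} K x _.

(* Only meaningful on bisector K x, where mnorm K (z - x) = mnorm K (z + x). *)
Definition Phi (R : realType) (n : nat) (K : set 'rV[R]_n) (x : 'rV[R]_n)
    (p : cpoint K) : 'rV[R]_n :=
  match p with
  | Ordinary z => (mnorm K (z - x))^-1 *: z
  | Ideal y => val y
  end.
Arguments Phi {R n} K x p.

(* Main.v *)
Require Import Defs.
From mathcomp Require Import all_boot all_order all_algebra.
From mathcomp Require Import all_classical all_reals all_analysis.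
From mathcomp Require Import ring lra.

Import Order.TTheory GRing.Theory Num.Theory.
Import numFieldNormedType.Exports.

Local Open Scope classical_set_scope.
Local Open Scope convex_scope.
Local Open Scope ring_scope.

(** Everything happens on lines parallel to x, where the norm N with unit ball K
    restricts to a convex function s |-> N (p + s x); the line meets the
    interior of K exactly when this function falls below 1 somewhere.

    An ordinary bisector point z with t = N (z - x) = N (z + x) rescales to
    w = z / t with N (w - x / t) = N (w + x / t) = 1.  If the line through w
    parallel to x meets the interior of K, convexity forces the function to
    exceed 1 outside [- 1 / t, 1 / t], so the chord has w - x / t and w + x / t
    as its ends and w as its midpoint ([midpoint_of_chord]).  Otherwise the
    function is at least 1 everywhere and equal to 1 at w, so w lies on the
    shadow boundary.  Conversely, half the length of a nondegenerate chord is
    c = 1 / t for such a t ([equal_norm_ends_image]), and a degenerate chord is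
    a point of the shadow boundary ([chord_midpoint_cases]).

    Ideal points account for the shadow boundary.  If t_i u_i is on the
    bisector, then N (u_i - e x) = N (u_i + e x) >= N (u_i) = 1 for
    e = 1 / t_i.  Were the line through the limit of the u_i to enter the
    interior of K, the line through u_i would enter it for large i too, at a
    parameter further from 0 than e; then convexity would make the norm of
    u_i + e x or of u_i - e x less than 1, on the side of the entry
    ([ideal_point_in_shadow_boundary]).  Conversely, for y on the shadow
    boundary the function of s attains its minimum at s = 0, so the
    intermediate value theorem gives, for every e > 0, some s in [- e, e] where
    y + (s - e) x and y + (s + e) x have equal norms ([bisector_meets_line]).
    Then (y + s x) / e is on the bisector, and as e tends to 0 these points go
    to infinity in the direction y ([shadow_boundary_ideal_point]). *)

(** * The gauge of a symmetric convex body is a norm *)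

Section SymmetricBody.
Context (R : realType) (n : nat) (K : set 'rV[R]_n).
Hypotheses (hK : convex_body K) (hsym : centrally_symmetric K).
Implicit Types (a b p u v w x y z : 'rV[R]_n) (r s t c : R).

Let N := mnorm K.

Lemma body_convex a b t : K a -> K b -> 0 <= t <= 1 ->
  K ((1 - t) *: a + t *: b).
Proof.
move=> Ka Kb /andP[t0 t1]; case: hK => _ cK _.
have := cK b a (Itv01 t0 t1) (mem_set Kb) (mem_set Ka).
by rewrite inE addrC.
Qed.

(** Averaging a ball inside K with its mirror image recentres it at 0. *)
Lemma body_absorbs : exists2 r, 0 < r & forall w, `|w| < r -> K w.
Proof.
case: hK => _ _ [p /nbhs_normP[e /= e0 Be]].
exists (e / 2) => [|w we]; first by rewrite divr_gt0.
have Kp : K p by apply: Be; rewrite /ball_ /= subrr normr0.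
have Kq : K (p + 2 *: w).
  apply: Be; rewrite /ball_ /= opprD addNKr normrN normrZ ger0_norm //.
  by rewrite mulrC -ltr_pdivlMr.
have -> : w = (1 - 2^-1) *: (- p) + 2^-1 *: (p + 2 *: w).
  rewrite scalerDr scalerA mulVf // scale1r addrA scalerN.
  have -> : 1 - 2^-1 = 2^-1 :> R by field.
  by rewrite addNr add0r.
by apply: body_convex => //; [exact: hsym | lra].
Qed.

Lemma body0 : K 0.
Proof. by have [r r0 Kr] := body_absorbs; apply: Kr; rewrite normr0. Qed.

Lemma body_shrink c w : 0 <= c <= 1 -> K w -> K (c *: w).
Proof.
by move=> c01 Kw; have := body_convex 0 w c body0 Kw c01; rewrite scaler0 add0r.
Qed.

Lemma dilate_mem t z : 0 < t -> [set t *: y | y in K] z <-> K (t^-1 *: z).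
Proof.
move=> t0; have tN0 : t != 0 by rewrite gt_eqF.
split=> [[y Ky <-]|Kz]; first by rewrite scalerA mulVf // scale1r.
by exists (t^-1 *: z) => //; rewrite scalerA mulfV // scale1r.
Qed.

Lemma gauge_le z t : 0 < t -> K (t^-1 *: z) -> N z <= t.
Proof.
move=> t0 Kz; apply: ge_inf; last by split=> //; apply/dilate_mem.
by exists 0 => s [/ltW].
Qed.

(** This makes the infimum defining the gauge genuine: [inf] of an empty set is
    a default value. *)
Lemma gauge_set_nonempty z :
  [set t : R | 0 < t /\ [set t *: y | y in K] z] !=set0.
Proof.
have [r r0 Kr] := body_absorbs.
have t0 : 0 < (`|z| + 1) / r by rewrite divr_gt0 // ltr_wpDl.
exists ((`|z| + 1) / r); split=> //; apply/dilate_mem => //; apply: Kr.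
rewrite normrZ invf_div ger0_norm ?divr_ge0 ?ltW // ?ltr_wpDl //.
by rewrite mulrAC ltr_pdivrMr ?ltr_wpDl // ltr_pM2l // ltrDl.
Qed.

Lemma gauge_ge0 z : 0 <= N z.
Proof. by apply: lb_le_inf; [exact: gauge_set_nonempty | move=> t [/ltW]]. Qed.

Lemma body_of_gauge_lt z t : N z < t -> K (t^-1 *: z).
Proof.
move=> /(inf_lt (gauge_set_nonempty z)) [s [s0 /(dilate_mem _ _ s0) Kz] st].
have t0 := lt_trans s0 st.
have -> : t^-1 *: z = (s / t) *: (s^-1 *: z).
  by rewrite scalerA; congr (_ *: _); field; rewrite !gt_eqF.
apply: body_shrink => //; apply/andP; split; first by rewrite divr_ge0 // ltW.
by rewrite ler_pdivrMr // mul1r ltW.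
Qed.

Lemma gauge0 : N 0 = 0.
Proof.
apply/le_anti; rewrite gauge_ge0 andbT; apply/ler_addgt0Pr => e e0.
by rewrite add0r; apply: gauge_le => //; rewrite scaler0; exact: body0.
Qed.

Lemma gaugeN z : N (- z) = N z.
Proof.
have le w : N (- w) <= N w.
  apply/ler_addgt0Pr => e e0; apply: gauge_le.
    by rewrite ltr_wpDl // gauge_ge0.
  by rewrite scalerN; apply/hsym/body_of_gauge_lt; rewrite ltrDl.
by apply/le_anti; rewrite le /= -{1}[z]opprK le.
Qed.

Lemma gaugeZ c z : 0 <= c -> N (c *: z) = c * N z.
Proof.
rewrite le_eqVlt => /predU1P[<-|c0]; first by rewrite scale0r mul0r gauge0.
have le d w : 0 < d -> N (d *: w) <= d * N w.
  move=> d0; apply/ler_addgt0Pr => e e0; have Nw := gauge_ge0 w.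
  have s0 : 0 < d * N w + e by rewrite ltr_wpDl // mulr_ge0 // ltW.
  apply: gauge_le => //.
  have -> : (d * N w + e)^-1 *: (d *: w) = ((d * N w + e) / d)^-1 *: w.
    by rewrite scalerA; congr (_ *: _); field; rewrite !gt_eqF.
  by apply: body_of_gauge_lt; rewrite ltr_pdivlMr // mulrC ltrDl.
apply/le_anti; rewrite le //=.
rewrite -ler_pdivlMl //; have := le c^-1 (c *: z).
by rewrite scalerA mulVf ?gt_eqF // scale1r invr_gt0; exact.
Qed.

Lemma gaugeD a b : N (a + b) <= N a + N b.
Proof.
apply/ler_addgt0Pr => e e0.
have Na := gauge_ge0 a; have Nb := gauge_ge0 b.
pose s := N a + e / 2; pose t := N b + e / 2.
have s0 : 0 < s by rewrite /s; lra.
have t0 : 0 < t by rewrite /t; lra.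
have -> : N a + N b + e = s + t by rewrite /s /t; field.
have st0 : 0 < s + t by rewrite addr_gt0.
apply: gauge_le => //.
have -> : (s + t)^-1 *: (a + b) =
    (1 - t / (s + t)) *: (s^-1 *: a) + (t / (s + t)) *: (t^-1 *: b).
  rewrite scalerDr !scalerA; congr (_ *: _ + _ *: _); field.
    by rewrite !gt_eqF.
  by rewrite !gt_eqF.
apply: body_convex.
- by apply: body_of_gauge_lt; rewrite /s; lra.
- by apply: body_of_gauge_lt; rewrite /t; lra.
- apply/andP; split; first by rewrite divr_ge0 // ltW.
  by rewrite ler_pdivrMr // mul1r lerDr ltW.
Qed.

Lemma gauge_midpoint a b : 2 * N a <= N (a - b) + N (a + b).
Proof.
rewrite -gaugeZ // scaler_nat mulr2n.
have -> : a + a = (a - b) + (a + b) by rewrite addrACA addNr addr0.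
exact: gaugeD.
Qed.

(** The comparison with the ambient norm is what makes the gauge continuous. *)
Lemma gauge_bounded : exists2 C, 0 < C & forall w, N w <= C * `|w|.
Proof.
have [r r0 Kr] := body_absorbs; exists (2 / r) => [|w]; first exact: divr_gt0.
have [->|w0] := eqVneq w 0; first by rewrite gauge0 normr0 mulr0.
have nw : 0 < `|w| by rewrite normr_gt0.
have c0 : 0 < 2 / r * `|w| by rewrite mulr_gt0 // divr_gt0.
apply: gauge_le => //; apply: Kr; rewrite normrZ gtr0_norm ?invr_gt0 //.
have -> : (2 / r * `|w|)^-1 * `|w| = r / 2 by field; rewrite !gt_eqF.
by lra.
Qed.

Lemma gauge_continuous : continuous N.
Proof.
move=> z; apply/(@cvgrPdist_lt _ _ _ _ (nbhs_filter z)) => e e0.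
have [C C0 NC] := gauge_bounded.
have eC : 0 < e / C by rewrite divr_gt0.
apply: (proj2 (@nbhs_normP R ('rV[R]_n : normedModType R) z _)).
exists (e / C) => //= w; rewrite /ball_ /= => zw.
apply: le_lt_trans (_ : C * `|z - w| < e); last by rewrite mulrC -ltr_pdivlMr.
apply: le_trans (NC _); rewrite ler_norml.
have h1 : N z <= N w + N (z - w) by rewrite -{1}[z](subrK w) addrC gaugeD.
have h2 : N w <= N z + N (z - w).
  by rewrite -[N (z - w)]gaugeN opprB -{1}[w](subrK z) addrC gaugeD.
lra.
Qed.

(** The forward implication needs K closed: z is the limit of the points
    z / (1 + 1 / (k + 1)), which lie in K. *)
Lemma gauge_le1 z : N z <= 1 <-> K z.
Proof.
split=> [Nz|Kz]; last by apply: gauge_le => //; rewrite invr1 scale1r.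
case: hK => cptK _ _; have clK := compact_closed (@norm_hausdorff _ _) cptK.
pose f k : 'rV[R]_n := (1 + harmonic k)^-1 *: z.
apply: (@closed_cvg _ _ \oo _ f K clK).
  apply: nearW => k; apply: body_of_gauge_lt; apply: le_lt_trans Nz _.
  by rewrite ltrDl harmonic_gt0.
rewrite -[X in _ --> X]scale1r; apply: cvgZr_tmp.
rewrite -[X in _ --> X]invr1; apply: cvgV; first by rewrite oner_eq0.
rewrite -[X in _ --> X]addr0.
by apply: cvgD; [exact: cvg_cst | exact: cvg_harmonic].
Qed.

Lemma gauge_lt1 z : N z < 1 <-> K° z.
Proof.
split=> [Nz|Kz].
  have : \forall w \near z, N w < 1.
    exact: (cvgr_lt (N z) (gauge_continuous z)).
  by apply: filterS => w Nw; apply/gauge_le1/ltW.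
move: Kz => /nbhs_normP[e /= e0 Be].
(* The constant d makes z (1 + d) stay within e of z. *)
pose d := e / (2 * (`|z| + 1)).
have d0 : 0 < d by rewrite divr_gt0 // mulr_gt0 // ltr_wpDl.
have Kd : K ((1 + d) *: z).
  apply: Be; rewrite /ball_ /= scalerDl scale1r opprD addNKr normrN normrZ.
  rewrite ger0_norm ?ltW // /d mulrAC ltr_pdivrMr ?mulr_gt0 ?ltr_wpDl //.
  by rewrite ltr_pM2l //; have := normr_ge0 z; lra.
have /gauge_le1 := Kd; rewrite gaugeZ; last by lra.
have := gauge_ge0 z; nra.
Qed.


(** * The norm on lines parallel to x *)

Lemma gauge_line_convex p x r s t c : 0 <= c <= 1 -> s = (1 - c) * r + c * t ->
  N (p + s *: x) <= (1 - c) * N (p + r *: x) + c * N (p + t *: x).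
Proof.
move=> /andP[c0 c1] ->.
have -> : p + ((1 - c) * r + c * t) *: x =
    (1 - c) *: (p + r *: x) + c *: (p + t *: x).
  rewrite !scalerDr addrACA -scalerDl subrK scale1r.
  by rewrite !scalerA -scalerDl.
by apply: le_trans (gaugeD _ _) _; rewrite !gaugeZ ?subr_ge0.
Qed.

(** A convex function that is below 1 at r and at least 1 at s > r has already
    crossed the level 1 at s, so it exceeds 1 beyond s. *)
Lemma gauge_line_le p x r s t : N (p + r *: x) < 1 -> 1 <= N (p + s *: x) ->
  N (p + t *: x) <= 1 -> r < s -> t <= s.
Proof.
move=> Nr Ns Nt rs; rewrite leNgt; apply/negP => st.
have rt : 0 < t - r by lra.
pose c := (s - r) / (t - r).
have c0 : 0 < c by rewrite divr_gt0 // subr_gt0.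
have c1 : c < 1 by rewrite ltr_pdivrMr // mul1r; lra.
have sE : s = (1 - c) * r + c * t by rewrite /c; field; rewrite gt_eqF.
have := gauge_line_convex p x r s t c _ sE; rewrite (ltW c0) (ltW c1).
move=> /(_ isT); nra.
Qed.

Lemma gauge_line_ge p x r s t : N (p + r *: x) < 1 -> 1 <= N (p + s *: x) ->
  N (p + t *: x) <= 1 -> s < r -> s <= t.
Proof.
have NN c : N (p + c *: x) = N (p + (- c) *: (- x)).
  by rewrite scalerN scaleNr opprK.
rewrite !NN => Nr Ns Nt sr; rewrite -lerN2.
by apply: gauge_line_le Nr Ns Nt _; rewrite ltrN2.
Qed.

Lemma gauge_line_continuous p x : continuous (fun s : R => N (p + s *: x)).
Proof.
move=> s; apply: (@continuous_comp _ _ _ (fun s : R => p + s *: x) N).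
  by apply: cvgD; [exact: cvg_cst | apply: cvgZr_tmp; exact: cvg_id].
exact: gauge_continuous.
Qed.

(** The form of the shadow boundary used throughout: the interior of K is the
    open unit ball, so a line avoids it when the norm is at least 1 on it. *)
Lemma shadow_boundaryP x y :
  shadow_boundary K x y <-> N y = 1 /\ forall s, 1 <= N (y + s *: x).
Proof.
split=> [[Ny [_ [[p _ <-] [_ disj]] [r _ yE]]]|[Ny Nline]]; split=> //.
  move=> s; rewrite leNgt; apply/negP => /gauge_lt1 ints.
  suff : set0 (y + s *: x) by [].
  rewrite -disj; split=> //; exists (r + s) => //.
  by rewrite scalerDl addrA yE.
exists (range (fun s : R => y + s *: x)); last first.
  by exists 0 => //; rewrite scale0r addr0.
split; first by exists y.
split.
  exists y; split; last by apply/gauge_le1; rewrite Ny.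
  by exists 0 => //; rewrite scale0r addr0.
apply/seteqP; split=> // _ [[s _ <-] /gauge_lt1].
by rewrite ltNge Nline.
Qed.

(** * Midpoints of chords *)

Lemma segmentP a b v :
  segment a b v <-> exists2 t, 0 <= t <= 1 & v = t *: a + (1 - t) *: b.
Proof.
split=> [[t _ <-]|[t /andP[t0 t1] ->]]; last by exists (Itv01 t0 t1).
by exists t%:num => //; apply/andP; split.
Qed.

(** The two points at level 1 are the ends of the chord because the interior
    point of the line must lie between them, after which the norm exceeds 1
    beyond each of them. *)
Lemma midpoint_of_chord w x c : 0 < c ->
  N (w - c *: x) = 1 -> N (w + c *: x) = 1 ->
  (exists s, N (w + s *: x) < 1) -> chord_midpoints K x w.
Proof.
move=> c0 Nm Np [r Nr].
have Nl : N (w + (- c) *: x) = 1 by rewrite scaleNr.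
have Np1 : 1 <= N (w + c *: x) by rewrite Np.
have Nl1 : 1 <= N (w + (- c) *: x) by rewrite Nl.
have Np2 : N (w + c *: x) <= 1 by rewrite Np.
have Nl2 : N (w + (- c) *: x) <= 1 by rewrite Nl.
have rc : - c < r < c.
  apply/andP; split; rewrite ltNge le_eqVlt; apply/negP => /predU1P[rE|rlt].
  - by move: Nr; rewrite rE Nl ltxx.
  - by have := gauge_line_le w x r (- c) c Nr Nl1 Np2 rlt; lra.
  - by move: Nr; rewrite -rE Np ltxx.
  - by have := gauge_line_ge w x r c (- c) Nr Np1 Nl2 rlt; lra.
have NK s : N (w + s *: x) <= 1 -> - c <= s <= c.
  case/andP: rc => cr rc Ns; apply/andP; split.
    exact: gauge_line_ge Nr Nl1 Ns cr.
  exact: gauge_line_le Nr Np1 Ns rc.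
exists (K `&` range (fun s : R => w + s *: x)).
  exists (range (fun s : R => w + s *: x)) => //; split; first by exists w.
  exists (w + c *: x); split; first by exists c.
  by apply/gauge_le1; rewrite Np.
exists (w - c *: x), (w + c *: x); split; last first.
  rewrite addrACA addNr addr0 -mulr2n -[w *+ 2]scaler_nat scalerA.
  by rewrite mulVf ?scale1r.
have segE t : t *: (w - c *: x) + (1 - t) *: (w + c *: x)
    = w + ((1 - 2 * t) * c) *: x.
  rewrite -scaleNr !scalerDr addrACA -scalerDl [t + _]addrC subrK scale1r.
  by rewrite !scalerA -scalerDl; congr (_ + _ *: _); ring.
apply/seteqP; split=> [v [/gauge_le1 Kv [s _ sE]]|_ /segmentP[t t01 ->]].
  move: Kv; rewrite -sE => /NK sc; apply/segmentP; exists ((1 - s / c) / 2).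
    have : -1 <= s / c <= 1.
      by rewrite ler_pdivlMr // ler_pdivrMr // mulN1r mul1r.
    lra.
  by rewrite segE; congr (_ + _ *: _); field; rewrite gt_eqF.
split; last by rewrite segE; exists ((1 - 2 * t) * c).
rewrite addrC; have -> : t *: (w - c *: x) = (1 - (1 - t)) *: (w - c *: x).
  by rewrite subKr.
rewrite addrC; apply: body_convex; [| |lra]; apply/gauge_le1.
  by rewrite Nm.
by rewrite Np.
Qed.

(** A point of the line with norm below 1 can be moved along the line in both
    directions without leaving K.  The ends of the chord cannot, hence have
    norm 1; when the ends coincide no point of the line can, so the line
    avoids the interior. *)
Lemma chord_midpoint_cases x m : N x = 1 -> chord_midpoints K x m ->
  shadow_boundary K x m \/
  exists c, [/\ 0 < c, N (m - c *: x) = 1 & N (m + c *: x) = 1].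
Proof.
move=> Nx [_ [_ [[p _ <-] _] <-] [a [b [CE ->]]]].
pose L := range (fun s : R => p + s *: x).
have {}CE : K `&` L = segment a b := CE.
have Lline v s : L v -> L (v + s *: x).
  by move=> [r _ <-]; exists (r + s) => //; rewrite scalerDl addrA.
have [Ka La] : (K `&` L) a.
  rewrite CE; apply/segmentP; exists 1; first by lra.
  by rewrite subrr scale0r addr0 scale1r.
have [Kb Lb] : (K `&` L) b.
  rewrite CE; apply/segmentP; exists 0; first by lra.
  by rewrite subr0 scale0r add0r scale1r.
have [d bE] : exists d, b = a + d *: x.
  case: La Lb => [r _ <-] [s _ <-]; exists (s - r).
  by rewrite -addrA -scalerDl [r + _]addrC subrK.
have xinj : injective (fun s : R => s *: x).
  move=> s r /eqP; rewrite -subr_eq0 -scalerBl scaler_eq0 subr_eq0.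
  case/orP=> /eqP // x0; move: Nx; rewrite x0 gauge0; lra.
(* Seen from a in units of x, the chord is the segment between 0 and d; the
   sign of d is unknown, hence the parameter u. *)
have segd s : N (a + s *: x) <= 1 -> exists2 u, 0 <= u <= 1 & s = u * d.
  move=> /gauge_le1 Ks; have : (K `&` L) (a + s *: x) by split; auto.
  rewrite CE => /segmentP[t t01]; rewrite bE scalerDr addrA -scalerDl.
  rewrite [t + _]addrC subrK scale1r scalerA => /addrI /xinj ->.
  by exists (1 - t) => //; lra.
have wiggle s : N (a + s *: x) < 1 -> exists2 e, 0 < e &
    N (a + (s - e) *: x) <= 1 /\ N (a + (s + e) *: x) <= 1.
  move=> /(cvgr_lt _ (gauge_line_continuous a x s)) /nbhs_normP[e /= e0 Be].
  exists (e / 2); first by lra.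
  split; apply/ltW/Be; rewrite /ball_ /=.
    by rewrite subKr gtr0_norm; lra.
  by rewrite opprD addNKr normrN gtr0_norm; lra.
have Na : N a = 1.
  apply/le_anti/andP; split; first exact/gauge_le1.
  rewrite leNgt; apply/negP; rewrite -[a]addr0 -(scale0r x).
  move=> /wiggle[e e0 [/segd[u u01 uE] /segd[v v01 vE]]].
  (* Both - e and e would lie on the same side of the end, whereas their
     product is negative. *)
  have : 0 <= u * v * d ^+ 2 by rewrite mulr_ge0 ?sqr_ge0 // mulr_ge0; lra.
  have -> : u * v * d ^+ 2 = (u * d) * (v * d) by ring.
  rewrite -uE -vE; nra.
have Nb : N b = 1.
  apply/le_anti/andP; split; first exact/gauge_le1.
  rewrite leNgt; apply/negP; rewrite bE.
  move=> /wiggle[e e0 [/segd[u u01 uE] /segd[v v01 vE]]].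
  have : 0 <= (1 - u) * (1 - v) * d ^+ 2.
    by rewrite mulr_ge0 ?sqr_ge0 // mulr_ge0; lra.
  have -> : (1 - u) * (1 - v) * d ^+ 2 = (d - u * d) * (d - v * d) by ring.
  rewrite -uE -vE; nra.
have mE : 2^-1 *: (a + b) = a + (d / 2) *: x.
  rewrite bE addrA -[a + a]mulr2n -[a *+ 2]scaler_nat scalerDr !scalerA.
  by rewrite mulVf // scale1r mulrC.
have [d0|d0|d0] := ltgtP d 0;
  [right; exists (- d / 2)|right; exists (d / 2)|left].
- rewrite mE -scaleNr -!addrA -!(scalerDl x).
  have -> : d / 2 + - (- d / 2) = d by field.
  have -> : d / 2 + (- d / 2) = 0 by field.
  by rewrite scale0r addr0 -bE; split=> //; lra.
- rewrite mE -scaleNr -!addrA -!(scalerDl x).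
  have -> : d / 2 + d / 2 = d by field.
  by rewrite subrr scale0r addr0 -bE; split=> //; lra.
rewrite mE d0 mul0r scale0r addr0; apply/shadow_boundaryP; split=> // s.
rewrite leNgt; apply/negP => /wiggle[e e0 [/segd[u _ uE] /segd[v _ vE]]].
by move: uE vE; rewrite d0 !mulr0; lra.
Qed.

(** * Points of the bisector *)

(** The bisector point is m / c, at distance 1 / c from both x and - x. *)
Lemma equal_norm_ends_image x m c : 0 < c ->
  N (m - c *: x) = 1 -> N (m + c *: x) = 1 ->
  [set Phi K x p | p in bisector K x] m.
Proof.
move=> c0 Nm Np.
have Nz (e : R) : N (c^-1 *: m + e *: x) = c^-1 * N (m + (e * c) *: x).
  rewrite -gaugeZ ?invr_ge0 ?ltW // scalerDr scalerA; congr (N (_ + _ *: _)).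
  by field; rewrite gt_eqF.
have Nzm : N (c^-1 *: m - x) = c^-1.
  by rewrite -scaleN1r Nz mulN1r scaleNr Nm mulr1.
have Nzp : N (c^-1 *: m + x) = c^-1.
  by rewrite -[x]scale1r Nz mul1r Np mulr1.
exists (Ordinary (c^-1 *: m)).
  by rewrite /bisector /= /bisector_ord /= -/N Nzm.
by rewrite /Phi -/N Nzm invrK scalerA mulfV ?gt_eqF // scale1r.
Qed.

(** The difference N (y + (s + e) x) - N (y + (s - e) x) changes sign on
    [- e, e]: at each end, one of the two arguments is y, which has least norm
    on the line. *)
Lemma bisector_meets_line x y e : 0 < e -> (forall s, N y <= N (y + s *: x)) ->
  exists2 s, - e <= s <= e & N (y + (s - e) *: x) = N (y + (s + e) *: x).
Proof.
move=> e0 ymin.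
pose g s := N (y + (s + e) *: x) - N (y + (s - e) *: x).
have gc : continuous g.
  have gcD (c : R) : continuous (fun s : R => N (y + (s + c) *: x)).
    move=> s; apply: (@continuous_comp _ _ _ (fun s : R => s + c)
      (fun s : R => N (y + s *: x))).
      by apply: cvgD; [exact: cvg_id | exact: cvg_cst].
    exact: gauge_line_continuous.
  by move=> s; apply: cvgB; exact: gcD.
have gl : g (- e) <= 0.
  by rewrite /g addNr scale0r addr0 subr_le0 ymin.
have gr : 0 <= g e.
  by rewrite /g subrr scale0r addr0 subr_ge0 ymin.
have [|||s] := @IVT R g (- e) e 0; first by lra.
- exact: continuous_subspaceT.
- by rewrite ge_min gl le_max gr orbT.
rewrite in_itv /= => se /eqP; rewrite subr_eq0 => /eqP gs.
by exists s.
Qed.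

(** With e = 1 / (k + 1) and s within e of 0, the points v = y + s x tend to y,
    and v / e is on the bisector.  Since N v may exceed 1, the direction is
    v / N v and the length N v / e. *)
Lemma shadow_boundary_ideal_point x y : shadow_boundary K x y ->
  exists i, bisector_ideal K x i /\ val i = y.
Proof.
move=> /shadow_boundaryP[Ny ymin].
exists (exist _ y (mem_set (Ny : msphere K y))); split=> //.
pose e (k : nat) : R := harmonic k.
have e0 k : 0 < e k by exact: harmonic_gt0.
have /choice[s sP] : forall k, exists s, - e k <= s <= e k /\
    N (y + (s - e k) *: x) = N (y + (s + e k) *: x).
  move=> k; have [|s sk sE] := bisector_meets_line x y (e k) (e0 k).
    by rewrite Ny.
  by exists s.
pose v k := y + s k *: x.
have v1 k : 1 <= N (v k) by exact: ymin.
have v0 k : 0 < N (v k) by exact: lt_le_trans (v1 k).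
have e_to0 : e @ \oo --> 0 by exact: cvg_harmonic.
have s_to0 : s @ \oo --> (0 : R).
  apply: (@squeeze_cvgr _ _ _ _ (fun k => - e k) e) => //.
    by apply: nearW => k; case: (sP k).
  by rewrite -oppr0; apply: cvgN.
have v_toy : v @ \oo --> y.
  rewrite -[X in _ --> X]addr0 -(scale0r x); apply: cvgD; first exact: cvg_cst.
  exact: cvgZr_tmp.
exists (fun k => (N (v k))^-1 *: v k), (fun k => N (v k) / e k); split.
- move=> k; rewrite /msphere /= -/N gaugeZ ?invr_ge0 ?ltW //.
  by rewrite mulVf // gt_eqF.
- by move=> k; rewrite divr_gt0.
- apply/cvgryPge => A; near=> k.
  apply: le_trans (_ : k%:R <= _); last first.
    rewrite /e /harmonic /= invrK; apply: le_trans (_ : k.+1%:R <= _).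
      by rewrite ler_nat.
    by rewrite ler_peMl.
  near: k; exact: nbhs_infty_ger.
- move=> k; rewrite /bisector_ord /= -/N scalerA.
  have -> : N (v k) / e k / N (v k) = (e k)^-1.
    by rewrite mulrAC mulfV ?mul1r // gt_eqF.
  have Ne (c : R) : N ((e k)^-1 *: v k + c *: x) =
      (e k)^-1 * N (y + (s k + c * e k) *: x).
    rewrite -gaugeZ ?invr_ge0 ?ltW // (scalerDl x) addrA.
    by rewrite [in RHS]scalerDr scalerA mulrCA mulVf ?mulr1 // gt_eqF.
  have := Ne (-1); rewrite scaleN1r mulN1r => ->.
  have := Ne 1; rewrite scale1r mul1r => ->.
  by case: (sP k) => _ ->.
have Nv : (fun k => N (v k)) @ \oo --> (1 : R).
  by rewrite -Ny; apply: (cvg_comp v N v_toy (gauge_continuous y)).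
have NvV : (fun k => (N (v k))^-1) @ \oo --> (1 : R).
  by rewrite -[X in _ --> X]invr1; apply: cvgV => //; exact: oner_neq0.
by rewrite /= -[X in _ --> X]scale1r; exact: cvgZ.
Unshelve. all: by end_near.
Qed.

(** If the line through the limit had a point with norm below 1 at parameter r,
    so would the line through u k for k large.  Walking from r towards 0, the
    norm is at least 1 already at parameter e or - e, strictly before 0, so
    convexity would make it exceed 1 at 0, where it equals 1. *)
Lemma ideal_point_in_shadow_boundary x (i : msphere K) :
  bisector_ideal K x i -> shadow_boundary K x (val i).
Proof.
move=> [u [t [uS t0 too uB uy]]].
have Ny : N (val i) = 1 by have := valP i; rewrite inE.
apply/shadow_boundaryP; split=> // r; rewrite leNgt; apply/negP => Nr.
have r0 : r != 0 by apply/eqP => r0; move: Nr; rewrite r0 scale0r addr0 Ny ltxx.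
have Nur : \forall k \near \oo, N (u k + r *: x) < 1.
  apply: (cvgr_lt (N (val i + r *: x))) Nr.
  apply: (cvg_comp (fun k => u k + r *: x) N); last exact: gauge_continuous.
  by apply: cvgD => //; exact: cvg_cst.
have tr : \forall k \near \oo, `|r|^-1 < t k by apply: cvgry_gt.
have [k [Nk tk]] : exists k, N (u k + r *: x) < 1 /\ `|r|^-1 < t k.
  by near (\oo : set_system nat) => k; exists k; split; near: k.
have tk0 := t0 k; have Nu : N (u k) = 1 := uS k.
pose e := (t k)^-1.
have e0 : 0 < e by rewrite invr_gt0.
have er : e < `|r| by rewrite invf_plt // posrE normr_gt0.
have Ne : N (u k + e *: x) = N (u k - e *: x).
  have := uB k; rewrite /bisector_ord /= -/N => uBk.
  have Nt (c : R) : N (u k + (c * e) *: x) = e * N (t k *: u k + c *: x).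
    rewrite -gaugeZ ?ltW // scalerDr !scalerA /e mulVf ?gt_eqF // scale1r.
    by rewrite [c * _]mulrC.
  have := Nt 1; rewrite mul1r scale1r -uBk => ->.
  by have := Nt (-1); rewrite mulN1r scaleNr scaleN1r => ->.
have mid : 1 <= N (u k + e *: x).
  by have := gauge_midpoint (u k) (e *: x); rewrite Nu -Ne; lra.
have Nu0 : N (u k + 0 *: x) <= 1 by rewrite scale0r addr0 Nu.
have [r1|r1|r1] := ltgtP r 0; last by rewrite r1 eqxx in r0.
  have mid' : 1 <= N (u k + (- e) *: x) by rewrite scaleNr -Ne.
  have := gauge_line_le (u k) x r (- e) 0 Nk mid' Nu0.
  by move: er; rewrite ltr0_norm //; lra.
have := gauge_line_ge (u k) x r e 0 Nk mid Nu0.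
by move: er; rewrite gtr0_norm //; lra.
Unshelve. all: by end_near.
Qed.

Lemma ordinary_point_in_union x z : N x = 1 -> bisector_ord K x z ->
  (shadow_boundary K x `|` chord_midpoints K x) ((N (z - x))^-1 *: z).
Proof.
move=> Nx zB; have {}zB : N (z - x) = N (z + x) := zB.
set t := N (z - x) in zB *.
have t1 : 1 <= t.
  have := gauge_midpoint x z.
  by rewrite Nx -[N (x - z)]gaugeN opprB -/t [x + z]addrC -zB; lra.
have t0 : 0 < t by exact: lt_le_trans t1.
have c0 : 0 < t^-1 by rewrite invr_gt0.
have Nm : N (t^-1 *: z - t^-1 *: x) = 1.
  by rewrite -scalerBr gaugeZ ?ltW // -/t mulVf // gt_eqF.
have Np : N (t^-1 *: z + t^-1 *: x) = 1.
  by rewrite -scalerDr gaugeZ ?ltW // -zB mulVf // gt_eqF.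
have [inside|outside] := pselect (exists s, N (t^-1 *: z + s *: x) < 1).
  by right; exact: midpoint_of_chord c0 Nm Np inside.
have ge1 s : 1 <= N (t^-1 *: z + s *: x).
  by rewrite leNgt; apply/negP => ?; apply: outside; exists s.
left; apply/shadow_boundaryP; split=> //.
apply/le_anti/andP; split; last by have := ge1 0; rewrite scale0r addr0.
by have := gauge_midpoint (t^-1 *: z) (t^-1 *: x); rewrite Nm Np; lra.
Qed.

End SymmetricBody.

Theorem lemma1 (R : realType) (n : nat) (K : set 'rV[R]_n) (x : 'rV[R]_n)
  (hK : convex_body K) (hsym : centrally_symmetric K) (hx : msphere K x) :
  [set Phi K x p | p in bisector K x] =
  shadow_boundary K x `|` chord_midpoints K x.
Proof.
have Nx : mnorm K x = 1 := hx.
apply/seteqP; split=> [_ [[z|i] pB <-]|y [yS|yM]].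
- exact: ordinary_point_in_union.
- by left; exact: ideal_point_in_shadow_boundary.
- have [i [iB <-]] := shadow_boundary_ideal_point _ _ _ hK hsym _ _ yS.
  by exists (Ideal i).
have [yS|[c [c0 Nm Np]]] := chord_midpoint_cases _ _ _ hK hsym _ _ Nx yM.
  have [i [iB <-]] := shadow_boundary_ideal_point _ _ _ hK hsym _ _ yS.
  by exists (Ideal i).
exact: (equal_norm_ends_image _ _ _ hK hsym _ _ _ c0 Nm Np).
Qed.
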